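(* Let $k,r\in\mathbb{N}$ and let $G$ be a countably infinite, one-way $k$-locally finite graph. (i) If $k=2$, then $\mathrm{Rd}_r(G)\geq 1/r$ (for every $r\ge 1$). (ii) If $k\geq 2$, then $\mathrm{Rd}_2(G)\geq \frac{1}{2(k-1)}$. (iii) If $r\geq 3$ and $k\geq 3$, then $\mathrm{Rd}_r(G)\geq \frac{1}{\sum_{i=0}^{(k-2)r+1}(r-1)^i}\geq \frac{1}{r^{(k-2)r+1}}$.
   Context: $K_{\mathbb{N}}$ is the complete graph on vertex set $\mathbb{N}=\{1,2,\dots\}$. An $r$-coloring is a map from the edges of $K_\mathbb{N}$ to $[r]=\{1,\dots,r\}$. A copy of a graph $G$ in $K_\mathbb{N}$ is a subgraph of $K_\mathbb{N}$ isomorphic to $G$; it is monochromatic if all its edges receive the same color. For $V\subseteq\mathbb{N}$ the upper density is $\overline{d}(V)=\limsup_{t\to\infty}|V\cap\{1,\dots,t\}|/t$, and the upper density of a copy is the upper density of its vertex set. For an $r$-coloring $\varphi$, $\mathrm{Rd}_\varphi(G)$ is the supremum of upper densities of monochromatic copies of $G$ in $\varphi$ (0 if none), and $\mathrm{Rd}_r(G)$ is the infimum of $\mathrm{Rd}_\varphi(G)$ over all $r$-colorings $\varphi$; $\mathrm{Rd}(G)=\mathrm{Rd}_2(G)$. A graph $G$ is one-way $k$-locally finite ($k\ge2$) if there is a partition of $V(G)$ into $k$ independent sets $V_1,\dots,V_k$ with $|V_1|\geq\dots\geq|V_k|$ such that for all $1\le i<j\le k$ and all $v\in V_j$, $v$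 has only finitely many neighbors in $V_i$. *)

(* Defs.v *)
From Stdlib Require Import Reals Lia List.
From Stdlib Require Import ClassicalDescription.
From Coquelicot Require Import Coquelicot.
Open Scope R_scope.

(* Convention: the vertex set N = {1,2,...} of K_N is represented by Rocq's
   nat = {0,1,...}, the Rocq vertex n standing for the paper's vertex n+1. *)

Fixpoint count_below (A : nat -> Prop) (t : nat) : nat :=
  match t with
  | O => O
  | S t' => (count_below A t' +
             (if excluded_middle_informative (A t') then 1 else 0))%nat
  end.

Definition upper_density (A : nat -> Prop) : Rbar :=
  LimSup_seq (fun t => INR (count_below A (S t)) / INR (S t)).

(* An r-coloring of the edges of K_N: the colour of the edge {x,y} (x <> y)
   is col (min x y) (max x y), which must lie in [r] = {1,...,r}. *)
Definition is_coloring (r : nat) (col : nat -> nat -> nat) : Prop :=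
  forall x y : nat, (x < y)%nat -> (1 <= col x y <= r)%nat.

Definition edge_color (col : nat -> nat -> nat) (x y : nat) : nat :=
  col (Nat.min x y) (Nat.max x y).

Definition simple_graph (V : Type) (adj : V -> V -> Prop) : Prop :=
  (forall u v, adj u v -> adj v u) /\ (forall u, ~ adj u u).

Definition countably_infinite (V : Type) : Prop :=
  exists f : V -> nat,
    (forall x y, f x = f y -> x = y) /\ (forall n, exists x, f x = n).

Definition card_le {V : Type} (B A : V -> Prop) : Prop :=
  exists f : V -> V, (forall x, B x -> A (f x)) /\
    (forall x y, B x -> B y -> f x = f y -> x = y).

Definition finite_set {V : Type} (A : V -> Prop) : Prop :=
  exists l : list V, forall x, A x -> In x l.

(* One-way k-locally finite: partition V into independent sets
   V_1,...,V_k (here V_{i+1} = {v | part v = i}, i < k) with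
   |V_1| >= ... >= |V_k|, such that for i < j every v in V_j has only
   finitely many neighbours in V_i. *)
Definition one_way_locally_finite (k : nat) (V : Type) (adj : V -> V -> Prop)
  : Prop :=
  (2 <= k)%nat /\
  exists part : V -> nat,
    (forall v, (part v < k)%nat) /\
    (forall u v, adj u v -> part u <> part v) /\
    (forall i, (S i < k)%nat ->
       card_le (fun v => part v = S i) (fun v => part v = i)) /\
    (forall i j v, (i < j)%nat -> (j < k)%nat -> part v = j ->
       finite_set (fun u => part u = i /\ adj v u)).

(* A copy of G in K_N is given by an injective map emb : V -> N; the copy
   is the subgraph with vertex set emb(V) and edges {emb u, emb v}, uv in E(G).
   It is monochromatic (in colour c) if all its edges get colour c. *)
Definition mono_copy (V : Type) (adj : V -> V -> Prop)
  (col : nat -> nat -> nat) (emb : V -> nat) : Prop :=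
  (forall x y, emb x = emb y -> x = y) /\
  exists c : nat, forall u v, adj u v -> edge_color col (emb u) (emb v) = c.

(* Rd_phi(G): sup of upper densities of monochromatic copies (0 if none). *)
Definition Rd_col (V : Type) (adj : V -> V -> Prop) (col : nat -> nat -> nat)
  : Rbar :=
  Rbar_lub (fun d => d = Finite 0 \/
    exists emb : V -> nat, mono_copy V adj col emb /\
      d = upper_density (fun n => exists v, emb v = n)).

Definition Rd (r : nat) (V : Type) (adj : V -> V -> Prop) : Rbar :=
  Rbar_glb (fun d => exists col, is_coloring r col /\ d = Rd_col V adj col).

(* Main.v *)
Require Import Defs.
From Stdlib Require Import Reals.
From Stdlib Require Import Lia Lra List Classical.
From Stdlib Require Import ClassicalEpsilon ClassicalDescription.
From Coquelicot Require Import Coquelicot.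
Open Scope R_scope.

(** Every infinite [S] contains an infinite cohesive [C]: each vertex [v] sends
    a single colour [chi v] to almost all of [C], and [chi] is constant, say
    [c0], on [C].  The class [chi = c0] of [S] is covered by a copy of [G] in
    colour [c0], so it may be assumed to have density below
    [delta = 1 / (1 + (r-1) + ... + (r-1)^N)], [N = (k-2) r + 1].  Some other class
    [S'] then keeps a share [1/(r-1)] of what is left, and all of it sends the
    colour [c] of that class to almost all of [C].  Iterating
    [N] times inside [S'], one colour [c] occurs [k-1] times; the
    corresponding sets [C], in reverse order, host [V_2], ..., [V_k], while
    [V_1] covers the current [S], which has density at least [delta].  For
    [r = 2] or [k = 2], [1 / delta] is [2(k-1)], respectively [r], so that the three parts are one bound. *)

Definition infinite_nat (A : nat -> Prop) : Prop :=
  forall N, exists n, (N <= n)%nat /\ A n.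

(** ** Cohesive sets *)

Lemma infinite_pigeonhole (r : nat) :
  forall (T : nat -> Prop) (f : nat -> nat),
    infinite_nat T -> (forall w, T w -> (1 <= f w <= r)%nat) ->
    exists c, (1 <= c <= r)%nat /\ infinite_nat (fun w => T w /\ f w = c).
Proof.
  induction r as [|r IH]; intros T f HT Hf.
  - destruct (HT 0%nat) as [w [_ Hw]]. specialize (Hf w Hw). lia.
  - destruct (classic (infinite_nat (fun w => T w /\ f w = S r))) as [H|H].
    + exists (S r). split; [lia | exact H].
    + apply not_all_ex_not in H. destruct H as [M HM].
      destruct (IH (fun w => T w /\ (M <= w)%nat) f) as [c [Hc Hinf]].
      * intros N. destruct (HT (N + M)%nat) as [w [Hw1 Hw2]].
        exists w. repeat split; auto; lia.
      * intros w [Hw1 Hw2]. specialize (Hf w Hw1).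
        assert (f w <> S r) by (intros E; apply HM; exists w; auto). lia.
      * exists c. split; [lia|]. intros N.
        destruct (Hinf N) as [w [Hw1 [[Hw2 _] Hw3]]]. exists w; auto.
Qed.

(** The threshold may always be raised past [v], so the meaningless value of [edge_color] at [w = v]
    does no harm. *)
Definition attached (col : nat -> nat -> nat) (c : nat) (C : nat -> Prop)
  (v : nat) : Prop :=
  exists M, forall w, C w -> (M <= w)%nat -> edge_color col v w = c.

Lemma attached_subset col c (C C' : nat -> Prop) v :
  (forall w, C' w -> C w) -> attached col c C v -> attached col c C' v.
Proof. intros HC [M HM]. exists M; auto. Qed.

Lemma edge_color_range r col x y :
  is_coloring r col -> x <> y -> (1 <= edge_color col x y <= r)%nat.
Proof. intros H Hxy. apply H. lia. Qed.

Lemma edge_color_sym col x y : edge_color col x y = edge_color col y x.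
Proof. unfold edge_color. now rewrite Nat.min_comm, Nat.max_comm. Qed.

Definition refine_by (col : nat -> nat -> nat) (T : nat -> Prop) (v c : nat)
  : nat -> Prop :=
  fun w => T w /\ (v < w)%nat /\ edge_color col v w = c.

Definition popular_color (r : nat) (col : nat -> nat -> nat)
  (T : nat -> Prop) (v : nat) : nat :=
  epsilon (inhabits 0%nat)
    (fun c => (1 <= c <= r)%nat /\ infinite_nat (refine_by col T v c)).

(** Step [m] treats the vertex [m] whether or not it lies in [T], so that every vertex of
    $\mathbb{N}$ eventually receives a colour. *)
Fixpoint refinement (r : nat) (col : nat -> nat -> nat) (T : nat -> Prop)
  (n : nat) : nat -> Prop :=
  match n with
  | O => T
  | S m => refine_by col (refinement r col T m) m
             (popular_color r col (refinement r col T m) m)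
  end.

Lemma popular_color_spec r col T v :
  is_coloring r col -> infinite_nat T ->
  (1 <= popular_color r col T v <= r)%nat /\
  infinite_nat (refine_by col T v (popular_color r col T v)).
Proof.
  intros Hcol HT. unfold popular_color. apply epsilon_spec.
  destruct (infinite_pigeonhole r (fun w => T w /\ (v < w)%nat)
              (edge_color col v)) as [c [Hc Hinf]].
  - intros N. destruct (HT (N + S v)%nat) as [w [Hw1 Hw2]].
    exists w. repeat split; auto; lia.
  - intros w [_ Hw]. apply edge_color_range; auto; lia.
  - exists c. split; auto. intros N.
    destruct (Hinf N) as [w [Hw1 [[Hw2 Hw3] Hw4]]].
    exists w. repeat split; auto.
Qed.

Lemma refinement_infinite r col T n :
  is_coloring r col -> infinite_nat T -> infinite_nat (refinement r col T n).
Proof.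
  intros Hcol HT. induction n as [|n IH]; simpl; auto.
  now apply popular_color_spec.
Qed.

Lemma refinement_decr r col T m n w :
  (m <= n)%nat -> refinement r col T n w -> refinement r col T m w.
Proof.
  induction 1 as [|n _ IH]; auto. intros [Hw _]. auto.
Qed.

Lemma bounded_initial_segment (W : nat -> nat) (v : nat) :
  exists M, forall n, (n <= v)%nat -> (W n < M)%nat.
Proof.
  induction v as [|v [M HM]].
  - exists (S (W 0%nat)). intros n Hn. replace n with 0%nat by lia. lia.
  - exists (M + S (W (S v)))%nat. intros n Hn.
    destruct (Nat.eq_dec n (S v)) as [->|Hne]; [lia|].
    specialize (HM n ltac:(lia)). lia.
Qed.

(** A diagonal argument: [W n] is picked from the [n]-th set of a decreasing sequence, so all but
    finitely many terms survive the refinement at [v] and see [v] in colour [chi v]. Pigeonhole then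
    makes [chi] constant on an infinite subset, and attachment passes to subsets. *)
Lemma cohesive_subset r col T :
  is_coloring r col -> infinite_nat T ->
  exists (C : nat -> Prop) (chi : nat -> nat) (c0 : nat),
    (forall w, C w -> T w) /\ infinite_nat C /\
    (forall v, (1 <= chi v <= r)%nat) /\ (1 <= c0 <= r)%nat /\
    (forall w, C w -> chi w = c0) /\
    (forall v, attached col (chi v) C v).
Proof.
  intros Hcol HT.
  set (chi := fun v => popular_color r col (refinement r col T v) v).
  set (W := fun n => epsilon (inhabits 0%nat)
                       (fun w => (n <= w)%nat /\ refinement r col T n w)).
  assert (HW : forall n, (n <= W n)%nat /\ refinement r col T n (W n)).
  { intros n. unfold W. apply epsilon_spec.
    exact (refinement_infinite r col T n Hcol HT n). }
  assert (Hchi : forall v, (1 <= chi v <= r)%nat).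
  { intros v. apply popular_color_spec; auto. now apply refinement_infinite. }
  set (D := fun w => exists n, w = W n).
  assert (HD : infinite_nat D).
  { intros N. exists (W N). split; [apply HW | now exists N]. }
  destruct (infinite_pigeonhole r D chi HD (fun w _ => Hchi w))
    as [c0 [Hc0 Hinf]].
  exists (fun w => D w /\ chi w = c0), chi, c0.
  split; [|split; [exact Hinf|split; [exact Hchi|split; [exact Hc0|split]]]].
  - intros w [[n ->] _]. apply (refinement_decr r col T 0 n); [lia|].
    apply HW.
  - now intros w [_ Hw].
  (* [M] exceeds [W 0], ..., [W v], so an element of [C] from [M] on is some [W n] with [n > v],
     hence lies in the refinement at [S v]. *)
  - intros v. destruct (bounded_initial_segment W v) as [M HM].
    exists M. intros w [[n ->] _] Hw.
    destruct (Nat.le_gt_cases n v) as [Hn|Hn].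
    + specialize (HM n Hn). lia.
    + destruct (HW n) as [_ H].
      apply (refinement_decr r col T (S v) n) in H; [|lia].
      simpl in H. apply H.
Qed.

(** ** Towers *)

(** Level [A 0] is to host $V_1$ and [A j] to host $V_{j+1}$. Whatever finite set of vertices is
    already used on lower levels, almost all of [A j] is joined to it in colour [c]. *)
Definition tower (col : nat -> nat -> nat) (c h : nat)
  (A : nat -> nat -> Prop) : Prop :=
  forall j, (1 <= j <= h)%nat ->
    infinite_nat (A j) /\
    forall i v, (i < j)%nat -> A i v -> attached col c (A j) v.

Definition has_tower (col : nat -> nat -> nat) (c h : nat) (T : nat -> Prop)
  : Prop :=
  exists A, tower col c h A /\ A 0%nat = T.

Lemma has_tower_0 col c T : has_tower col c 0 T.
Proof. exists (fun _ => T). split; auto. intros j Hj. lia. Qed.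

Lemma has_tower_subset col c h (T T' : nat -> Prop) :
  (forall w, T' w -> T w) -> has_tower col c h T -> has_tower col c h T'.
Proof.
  intros HT [A [HA H0]].
  exists (fun j => match j with O => T' | S _ => A j end). split; auto.
  intros [|j] Hj; [lia|]. destruct (HA (S j) Hj) as [H1 H2]. split; auto.
  intros [|i] v Hi Hv.
  - apply (H2 0%nat v); [lia|]. rewrite H0. auto.
  - now apply (H2 (S i) v).
Qed.

(** [C] is inserted as level 1 and the old levels move up by one. As [C] lies in the old base [T],
    its vertices are attached to the old levels; this is why sets found later host earlier parts. *)
Lemma has_tower_extend col c h (T T' C : nat -> Prop) :
  has_tower col c h T -> (forall w, T' w -> T w) -> (forall w, C w -> T w) ->
  infinite_nat C -> (forall v, T' v -> attached col c C v) ->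
  has_tower col c (S h) T'.
Proof.
  intros [A [HA H0]] HT' HC Hinf Hatt. subst T.
  exists (fun j => match j with O => T' | S O => C | S j' => A j' end).
  split; auto.
  intros [|[|j]] Hj; [lia| |].
  - split; auto. intros [|i] v Hi Hv; [auto | lia].
  - destruct (HA (S j) ltac:(lia)) as [H1 H2]. split; auto.
    intros [|[|i]] v Hi Hv.
    + apply (H2 0%nat v); [lia | auto].
    + apply (H2 0%nat v); [lia | auto].
    + apply (H2 (S i) v); [lia | auto].
Qed.

(** [C] itself serves as every level above the base: lying in [T], its own vertices are attached to
    it. *)
Lemma has_tower_constant col c h (T C : nat -> Prop) :
  (forall w, C w -> T w) -> infinite_nat C ->
  (forall v, T v -> attached col c C v) -> has_tower col c h T.
Proof.
  intros HC Hinf Hatt.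
  exists (fun j => match j with O => T | S _ => C end). split; auto.
  intros [|j] Hj; [lia|]. split; auto. intros [|i] v Hi Hv; auto.
Qed.

(** ** Embedding a one-way locally finite graph along a tower *)

Lemma card_le_finite (V : Type) (v0 : V) (B A : V -> Prop) :
  card_le B A -> finite_set A -> finite_set B.
Proof.
  intros [f [Hf Hinj]] [l Hl].
  exists (map (fun a => epsilon (inhabits v0) (fun x => B x /\ f x = a)) l).
  intros x Hx. apply in_map_iff. exists (f x). split; auto.
  destruct (epsilon_spec (inhabits v0) (fun y => B y /\ f y = f x))
    as [H1 H2]; eauto.
Qed.

Lemma finite_set_not_countably_infinite (V : Type) :
  countably_infinite V -> ~ finite_set (fun _ : V => True).
Proof.
  intros [f [_ Hsurj]] [l Hl].
  assert (H : incl (seq 0 (S (length l))) (map f l)).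
  { intros n _. destruct (Hsurj n) as [x <-]. apply in_map. auto. }
  apply NoDup_incl_length in H; [|apply seq_NoDup].
  rewrite length_seq, length_map in H. lia.
Qed.

Lemma finite_set_bounded_union (V : Type) (part : V -> nat) (k : nat) :
  (forall i, (i < k)%nat -> finite_set (fun v => part v = i)) ->
  finite_set (fun v => (part v < k)%nat).
Proof.
  induction k as [|k IH]; intros H.
  - exists nil. intros x Hx. lia.
  - destruct IH as [l Hl]; [intros i Hi; apply H; lia|].
    destruct (H k) as [l' Hl']; [lia|].
    exists (l ++ l'). intros x Hx. apply in_or_app.
    destruct (Nat.eq_dec (part x) k) as [E|E]; [right; auto|].
    left. apply Hl. lia.
Qed.

Lemma first_part_infinite (V : Type) (part : V -> nat) (k : nat) :
  countably_infinite V -> (forall v, (part v < k)%nat) ->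
  (forall i, (S i < k)%nat ->
     card_le (fun v => part v = S i) (fun v => part v = i)) ->
  ~ finite_set (fun v => part v = 0%nat).
Proof.
  intros Hinf Hk Hle H0.
  apply (finite_set_not_countably_infinite V Hinf).
  destruct Hinf as [f [_ Hs]]. destruct (Hs 0%nat) as [v0 _].
  destruct (finite_set_bounded_union V part k) as [l Hl].
  - induction i as [|i IH]; intros Hi; auto.
    apply (card_le_finite V v0 _ (fun v => part v = i)); auto.
    apply IH. lia.
  - exists l. auto.
Qed.

Section Embedding.

Variables (k : nat) (V : Type) (adj : V -> V -> Prop) (part : V -> nat).
Variables (col : nat -> nat -> nat) (c : nat) (A : nat -> nat -> Prop).
Hypothesis adj_sym : forall u v, adj u v -> adj v u.
Hypothesis Vinf : countably_infinite V.
Hypothesis part_lt : forall v, (part v < k)%nat.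
Hypothesis part_indep : forall u v, adj u v -> part u <> part v.
Hypothesis part_le : forall i, (S i < k)%nat ->
  card_le (fun v => part v = S i) (fun v => part v = i).
Hypothesis part_fin : forall i j v, (i < j)%nat -> (j < k)%nat ->
  part v = j -> finite_set (fun u => part u = i /\ adj v u).
Hypothesis Atower : tower col c (k - 1) A.
Hypothesis A0inf : infinite_nat (A 0%nat).

Definition in_dom (s : list (V * nat)) (v : V) : Prop := exists n, In (v, n) s.
Definition in_ran (s : list (V * nat)) (n : nat) : Prop := exists v, In (v, n) s.

(* The closure of the domain under neighbours in earlier parts guarantees that
   a vertex added later only has to be joined to earlier parts. *)
Record partial_copy (s : list (V * nat)) : Prop := {
  pc_fun : forall v m n, In (v, m) s -> In (v, n) s -> m = n;
  pc_inj : forall u v n, In (u, n) s -> In (v, n) s -> u = v;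
  pc_host : forall v n, In (v, n) s -> A (part v) n;
  pc_col : forall u v m n, In (u, m) s -> In (v, n) s -> adj u v ->
    edge_color col m n = c;
  pc_down : forall u v, in_dom s v -> adj v u -> (part u < part v)%nat ->
    in_dom s u }.

Lemma partial_copy_nil : partial_copy nil.
Proof.
  constructor; simpl; tauto || (intros u v [n []]).
Qed.

Lemma partial_copy_cons s v n :
  partial_copy s -> ~ in_dom s v -> ~ in_ran s n -> A (part v) n ->
  (forall u, adj v u -> (part u < part v)%nat -> in_dom s u) ->
  (forall u m, In (u, m) s -> (part u < part v)%nat ->
     edge_color col m n = c) ->
  partial_copy ((v, n) :: s).
Proof.
  intros Hs Hv Hn HA Hlow Hcol.
  (* Only placed neighbours in earlier parts matter: one in the same part contradicts independence,
     and one in a later part would by [pc_down] have forced [v] into the domain. *)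
  assert (Hnew : forall u m, In (u, m) s -> adj u v -> edge_color col m n = c).
  { intros u m Hu Huv. apply (Hcol u m Hu).
    destruct (Nat.lt_total (part u) (part v)) as [H|[H|H]]; auto.
    - now apply part_indep in Huv.
    - exfalso. apply Hv. apply (pc_down s Hs v u); auto. now exists m. }
  constructor.
  - intros w m m' [E|H] [E'|H'].
    + congruence.
    + injection E as -> ->. exfalso. apply Hv. now exists m'.
    + injection E' as -> ->. exfalso. apply Hv. now exists m.
    + exact (pc_fun s Hs w m m' H H').
  - intros u w m [E|H] [E'|H'].
    + congruence.
    + injection E as -> ->. exfalso. apply Hn. now exists w.
    + injection E' as -> ->. exfalso. apply Hn. now exists u.
    + exact (pc_inj s Hs u w m H H').
  - intros u m [E|H]; [injection E as -> ->; auto | now apply (pc_host s Hs)].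
  - intros u w m m' [E|H] [E'|H'] Huw.
    + injection E as -> ->. injection E' as -> ->.
      now apply part_indep in Huw.
    + injection E as -> ->. rewrite edge_color_sym. eauto.
    + injection E' as -> ->. eauto.
    + exact (pc_col s Hs u w m m' H H' Huw).
  - intros u w [m [E|H]] Hwu Hlt.
    + injection E as -> ->. destruct (Hlow u Hwu Hlt) as [m' Hm'].
      exists m'. now right.
    + destruct (pc_down s Hs u w) as [m' Hm']; auto; [now exists m|].
      exists m'. now right.
Qed.

Lemma in_ran_bounded (s : list (V * nat)) :
  exists M, forall n, in_ran s n -> (n < M)%nat.
Proof.
  induction s as [|[v m] s [M HM]].
  - exists 0%nat. intros n [v []].
  - exists (M + S m)%nat. intros n [u [E|H]].
    + injection E as _ ->. lia.
    + specialize (HM n (ex_intro _ u H)). lia.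
Qed.

Lemma attached_uniform (s : list (V * nat)) (C : nat -> Prop) (P : V -> Prop) :
  (forall u m, In (u, m) s -> P u -> attached col c C m) ->
  exists M, forall u m w, In (u, m) s -> P u -> C w -> (M <= w)%nat ->
    edge_color col m w = c.
Proof.
  induction s as [|[v n] s IH]; intros H.
  - exists 0%nat. intros u m w [].
  - destruct IH as [M HM].
    { intros u m Hu. apply (H u m). now right. }
    destruct (classic (P v)) as [Hv|Hv].
    + destruct (H v n) as [M' HM']; [now left | auto |].
      exists (M + M')%nat. intros u m w [E|Hu] HP Hw Hle.
      * injection E as <- <-. apply HM'; auto; lia.
      * apply (HM u m w); auto; lia.
    + exists M. intros u m w [E|Hu] HP Hw Hle.
      * injection E as <- <-. tauto.
      * apply (HM u m w); auto.
Qed.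

Lemma host_infinite j : (j < k)%nat -> infinite_nat (A j).
Proof.
  intros Hj. destruct j as [|j]; auto.
  apply (Atower (S j)). lia.
Qed.

Lemma partial_copy_add s v :
  partial_copy s ->
  (forall u, adj v u -> (part u < part v)%nat -> in_dom s u) ->
  exists s', partial_copy s' /\ incl s s' /\ in_dom s' v.
Proof.
  intros Hs Hlow. destruct (classic (in_dom s v)) as [Hv|Hv].
  { exists s. split; [|split]; auto using incl_refl. }
  destruct (in_ran_bounded s) as [M1 HM1].
  destruct (attached_uniform s (A (part v)) (fun u => (part u < part v)%nat))
    as [M2 HM2].
  { intros u m Hu Hlt. apply (Atower (part v)) with (i := part u); auto.
    - specialize (part_lt v). lia.
    - now apply (pc_host s Hs). }
  destruct (host_infinite (part v) (part_lt v) (M1 + M2)%nat) as [w [Hw HA]].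
  exists ((v, w) :: s). split; [|split].
  - apply partial_copy_cons; auto.
    + intros Hr. specialize (HM1 w Hr). lia.
    + intros u m Hu Hlt. apply (HM2 u m w); auto; lia.
  - apply incl_tl, incl_refl.
  - exists w. now left.
Qed.

Lemma partial_copy_add_list (P : V -> Prop) (l : list V) :
  (forall v, P v -> forall s, partial_copy s ->
     exists s', partial_copy s' /\ incl s s' /\ in_dom s' v) ->
  forall s, partial_copy s ->
  exists s', partial_copy s' /\ incl s s' /\
    forall v, In v l -> P v -> in_dom s' v.
Proof.
  intros HP. induction l as [|v l IH]; intros s Hs.
  - exists s. split; [|split]; auto using incl_refl. intros v [].
  - destruct (IH s Hs) as [s1 [H1 [H2 H3]]].
    destruct (classic (P v)) as [Hv|Hv].
    + destruct (HP v Hv s1 H1) as [s2 [G1 [G2 G3]]].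
      exists s2. split; [auto | split; [eapply incl_tran; eauto|]].
      intros u [<-|Hu] Hu'; auto. destruct (H3 u Hu Hu') as [n Hn].
      exists n. auto.
    + exists s1. split; [|split]; auto. intros u [<-|Hu] Hu'; tauto || auto.
Qed.

(** One-way local finiteness enters here, summed over the parts before that of [v]. *)
Lemma lower_neighbours_finite v :
  finite_set (fun u => adj v u /\ (part u < part v)%nat).
Proof.
  assert (H : forall m, (m <= part v)%nat ->
    finite_set (fun u => adj v u /\ (part u < m)%nat)).
  { induction m as [|m IH]; intros Hm.
    - exists nil. intros u [_ Hu]. lia.
    - destruct IH as [l Hl]; [lia|].
      destruct (part_fin m (part v) v) as [l' Hl']; auto.
      exists (l ++ l'). intros u [Hu1 Hu2]. apply in_or_app.
      destruct (Nat.eq_dec (part u) m) as [E|E]; [right; auto|].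
      left. apply Hl. split; auto. lia. }
  now apply H.
Qed.

(** The finitely many neighbours of [v] in earlier parts are placed first. The recursion descends
    through the parts, with [d] bounding the part index, and so terminates. *)
Lemma partial_copy_extend_dom : forall d v, (part v < d)%nat ->
  forall s, partial_copy s ->
  exists s', partial_copy s' /\ incl s s' /\ in_dom s' v.
Proof.
  induction d as [|d IH]; intros v Hd s Hs; [lia|].
  destruct (lower_neighbours_finite v) as [l Hl].
  destruct (partial_copy_add_list (fun u => (part u < part v)%nat) l)
    with (s := s) as [s1 [H1 [H2 H3]]]; auto.
  { intros u Hu. apply IH. lia. }
  destruct (partial_copy_add s1 v H1) as [s2 [G1 [G2 G3]]].
  { intros u Hu Hlt. apply H3; auto. }
  exists s2. split; [|split]; auto. eapply incl_tran; eauto.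
Qed.

Lemma partial_copy_extend_ran s n :
  partial_copy s -> A 0%nat n ->
  exists s', partial_copy s' /\ incl s s' /\ in_ran s' n.
Proof.
  intros Hs Hn. destruct (classic (in_ran s n)) as [Hr|Hr].
  { exists s. split; [|split]; auto using incl_refl. }
  assert (Hv : exists v, part v = 0%nat /\ ~ in_dom s v).
  { apply NNPP. intros H.
    apply (first_part_infinite V part k Vinf part_lt part_le).
    exists (map fst s). intros v Hv. apply NNPP. intros Hv'. apply H.
    exists v. split; auto. intros [m Hm]. apply Hv'.
    apply (in_map fst) in Hm. exact Hm. }
  destruct Hv as [v [Hv1 Hv2]].
  exists ((v, n) :: s). split; [|split].
  - apply partial_copy_cons; auto.
    + now rewrite Hv1.
    + intros u _ Hu. lia.
    + intros u m _ Hu. lia.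
  - apply incl_tl, incl_refl.
  - exists v. now left.
Qed.

(** * Back-and-forth construction of the whole copy *)

Variable f : V -> nat.
Hypothesis f_inj : forall x y, f x = f y -> x = y.

(** Step [n] goes forth by placing the vertex numbered [n] by [f], if there is one, and back by
    covering [n] when it lies in [A 0]. *)
Definition good_step (s : list (V * nat)) (n : nat) (s' : list (V * nat)) :=
  partial_copy s' /\ incl s s' /\
  (forall v, f v = n -> in_dom s' v) /\ (A 0%nat n -> in_ran s' n).

Lemma good_step_exists s n : partial_copy s -> exists s', good_step s n s'.
Proof.
  intros Hs.
  assert (H : exists s1, partial_copy s1 /\ incl s s1 /\
                forall v, f v = n -> in_dom s1 v).
  { destruct (classic (exists v, f v = n)) as [[v Hv]|Hno].
    - destruct (partial_copy_extend_dom (S (part v)) v) with (s := s)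
        as [s1 [H1 [H2 H3]]]; auto.
      exists s1. split; [|split]; auto. intros u Hu.
      replace u with v; auto. apply f_inj. congruence.
    - exists s. split; [|split]; auto using incl_refl.
      intros v Hv. exfalso. eauto. }
  destruct H as [s1 [H1 [H2 H3]]].
  destruct (classic (A 0%nat n)) as [Hn|Hn].
  - destruct (partial_copy_extend_ran s1 n H1 Hn) as [s2 [G1 [G2 G3]]].
    exists s2. split; [|split; [|split]]; auto; [eapply incl_tran; eauto|].
    intros v Hv. destruct (H3 v Hv) as [m Hm]. exists m. auto.
  - exists s1. split; [|split; [|split]]; auto. tauto.
Qed.

Fixpoint stage (n : nat) : list (V * nat) :=
  match n with
  | O => nil
  | S m => epsilon (inhabits nil) (good_step (stage m) m)
  end.

Lemma stage_partial_copy n : partial_copy (stage n).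
Proof.
  induction n as [|n IH]; [apply partial_copy_nil|].
  exact (proj1 (epsilon_spec (inhabits nil) _ (good_step_exists _ n IH))).
Qed.

Lemma stage_good_step n : good_step (stage n) n (stage (S n)).
Proof.
  simpl. apply epsilon_spec, good_step_exists, stage_partial_copy.
Qed.

Lemma stage_incl m n : (m <= n)%nat -> incl (stage m) (stage n).
Proof.
  induction 1 as [|n _ IH]; [apply incl_refl|].
  eapply incl_tran; [exact IH | apply stage_good_step].
Qed.

Definition limit_copy (v : V) : nat :=
  epsilon (inhabits 0%nat) (fun n => In (v, n) (stage (S (f v)))).

Lemma limit_copy_stage v : In (v, limit_copy v) (stage (S (f v))).
Proof.
  unfold limit_copy. apply epsilon_spec.
  apply (stage_good_step (f v)). reflexivity.
Qed.

Lemma limit_copy_pair u v : exists n,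
  In (u, limit_copy u) (stage n) /\ In (v, limit_copy v) (stage n).
Proof.
  exists (S (f u) + S (f v))%nat. split.
  - apply (stage_incl (S (f u))); [lia | apply limit_copy_stage].
  - apply (stage_incl (S (f v))); [lia | apply limit_copy_stage].
Qed.

Lemma limit_copy_mono : mono_copy V adj col limit_copy.
Proof.
  split.
  - intros x y E. destruct (limit_copy_pair x y) as [n [Hx Hy]].
    rewrite E in Hx. exact (pc_inj _ (stage_partial_copy n) _ _ _ Hx Hy).
  - exists c. intros u v Huv. destruct (limit_copy_pair u v) as [n [Hu Hv]].
    exact (pc_col _ (stage_partial_copy n) _ _ _ _ Hu Hv Huv).
Qed.

Lemma limit_copy_covers n : A 0%nat n -> exists v, limit_copy v = n.
Proof.
  intros Hn. destruct (stage_good_step n) as [_ [_ [_ H]]].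
  destruct (H Hn) as [v Hv]. exists v.
  (* Step [n] covers [n] by [v], and [limit_copy v] is read off after step [f v]; at a common later
     stage the two images must agree. *)
  apply (pc_fun _ (stage_partial_copy (S n + S (f v))) v).
  - apply (stage_incl (S (f v))); [lia | apply limit_copy_stage].
  - apply (stage_incl (S n)); [lia | exact Hv].
Qed.

End Embedding.

Lemma has_tower_mono_copy k V adj col c T :
  simple_graph V adj -> countably_infinite V ->
  one_way_locally_finite k V adj ->
  has_tower col c (k - 1) T -> infinite_nat T ->
  exists emb : V -> nat, mono_copy V adj col emb /\
    forall n, T n -> exists v, emb v = n.
Proof.
  intros [Hsym _] Hinf [_ [part [H1 [H2 [H3 H4]]]]] [A [HA <-]] HT.
  pose proof Hinf as [f [Hf _]].
  exists (limit_copy V adj part col c A f). split.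
  - now apply (limit_copy_mono k).
  - intros n. now apply (limit_copy_covers k).
Qed.

(** ** Upper density *)

(** Upper density at least [d] in elementary form. Its negation is a bound with a fixed gap from
    some point on, and such bounds add up over unions. *)
Definition dens_ge (A : nat -> Prop) (d : R) : Prop :=
  forall eps, 0 < eps -> forall N, exists n, (N <= n)%nat /\
    d - eps < INR (count_below A (S n)) / INR (S n).

Lemma count_below_le (A B : nat -> Prop) t :
  (forall n, A n -> B n) -> (count_below A t <= count_below B t)%nat.
Proof.
  intros H. induction t as [|t IH]; simpl; [lia|].
  destruct (excluded_middle_informative (A t)) as [HA|HA];
    destruct (excluded_middle_informative (B t)) as [HB|HB]; try lia.
  exfalso. auto.
Qed.

Lemma count_below_union (A B : nat -> Prop) t :
  (count_below (fun n => A n \/ B n) t <= count_below A t + count_below B t)%nat.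
Proof.
  induction t as [|t IH]; simpl; [lia|].
  destruct (excluded_middle_informative (A t)) as [HA|HA];
    destruct (excluded_middle_informative (B t)) as [HB|HB];
    destruct (excluded_middle_informative (A t \/ B t)) as [H|H];
    try lia; tauto.
Qed.

Lemma count_below_True t : count_below (fun _ => True) t = t.
Proof.
  induction t as [|t IH]; simpl; auto.
  destruct (excluded_middle_informative True); [lia | tauto].
Qed.

Lemma count_below_bounded (A : nat -> Prop) M t :
  (forall n, A n -> (n < M)%nat) -> (count_below A t <= M)%nat.
Proof.
  intros H. cut (count_below A t <= Nat.min t M)%nat; [lia|].
  induction t as [|t IH]; cbn [count_below]; [lia|].
  destruct (excluded_middle_informative (A t)) as [HA|HA]; [|lia].
  specialize (H t HA). lia.
Qed.

Lemma INR_S_pos n : 0 < INR (S n).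
Proof. apply lt_0_INR. lia. Qed.

Lemma dens_ge_subset (A B : nat -> Prop) d :
  (forall n, A n -> B n) -> dens_ge A d -> dens_ge B d.
Proof.
  intros H HA eps He N. destruct (HA eps He N) as [n [Hn Hlt]].
  exists n. split; auto. eapply Rlt_le_trans; [exact Hlt|].
  apply Rmult_le_compat_r.
  - apply Rlt_le, Rinv_0_lt_compat, INR_S_pos.
  - apply le_INR, count_below_le, H.
Qed.

Lemma not_dens_ge (A : nat -> Prop) d :
  ~ dens_ge A d -> exists eps N, 0 < eps /\
    forall n, (N <= n)%nat ->
      INR (count_below A (S n)) / INR (S n) <= d - eps.
Proof.
  intros H. apply not_all_ex_not in H. destruct H as [eps H].
  apply imply_to_and in H. destruct H as [He H].
  apply not_all_ex_not in H. destruct H as [N H].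
  exists eps, N. split; auto. intros n Hn. apply Rnot_lt_le. intros Hlt.
  apply H. exists n. auto.
Qed.

Lemma not_dens_ge_union (A B : nat -> Prop) a b :
  ~ dens_ge A a -> ~ dens_ge B b -> ~ dens_ge (fun n => A n \/ B n) (a + b).
Proof.
  intros HA HB H.
  apply not_dens_ge in HA. destruct HA as [e1 [N1 [He1 HA]]].
  apply not_dens_ge in HB. destruct HB as [e2 [N2 [He2 HB]]].
  (* Testing with [e1] alone is enough: the two bounds sum to [a + b - e1 - e2], below
     [a + b - e1]. *)
  destruct (H e1 He1 (N1 + N2)%nat) as [n [Hn Hlt]].
  specialize (HA n ltac:(lia)). specialize (HB n ltac:(lia)).
  assert (Hle : INR (count_below (fun n => A n \/ B n) (S n)) / INR (S n) <=
            INR (count_below A (S n)) / INR (S n) +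
            INR (count_below B (S n)) / INR (S n)).
  { unfold Rdiv. rewrite <- Rmult_plus_distr_r, <- plus_INR.
    apply Rmult_le_compat_r.
    - apply Rlt_le, Rinv_0_lt_compat, INR_S_pos.
    - apply le_INR, count_below_union. }
  lra.
Qed.

Lemma not_dens_ge_finite_union (X : nat -> Prop) (Y : nat -> nat -> Prop)
  (l : list nat) a b :
  ~ dens_ge X a -> (forall c, In c l -> ~ dens_ge (Y c) b) ->
  ~ dens_ge (fun n => X n \/ exists c, In c l /\ Y c n) (a + INR (length l) * b).
Proof.
  intros HX. induction l as [|c l IH]; intros HY H.
  - apply HX. simpl in H. replace (a + 0 * b) with a in H by ring.
    revert H. apply dens_ge_subset. intros n [Hn|[c [[] _]]]; auto.
  - refine (not_dens_ge_union _ (Y c) _ b (IH _) _ _).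
    + intros c' Hc'. apply HY. now right.
    + apply HY. now left.
    + cbn [length] in H. rewrite S_INR in H.
      replace (a + (INR (length l) + 1) * b)
        with (a + INR (length l) * b + b) in H by ring.
      revert H. apply dens_ge_subset.
      intros n [Hn|[c' [[->|Hc'] Hn]]]; eauto.
Qed.

Lemma dens_ge_infinite (A : nat -> Prop) d :
  0 < d -> dens_ge A d -> infinite_nat A.
Proof.
  intros Hd HA. apply NNPP. intros H.
  apply not_all_ex_not in H. destruct H as [M HM].
  assert (Hb : forall n, A n -> (n < M)%nat).
  { intros n Hn. apply Nat.nle_gt. intros Hle. apply HM. eauto. }
  (* As [N + 1 > 2 M / d], a count of at most [M] has ratio below [d / 2] from [N] on. *)
  destruct (nfloor_ex (2 * INR M / d)) as [N [_ HN]].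
  { apply Rdiv_le_0_compat; auto. pose proof (pos_INR M). lra. }
  destruct (HA (d / 2) ltac:(lra) N) as [n [Hn Hlt]].
  pose proof (le_INR _ _ (count_below_bounded A M (S n) Hb)) as Hc.
  apply (Rmult_lt_compat_r (INR (S n))) in Hlt; [|apply INR_S_pos].
  unfold Rdiv in Hlt. rewrite (Rmult_assoc (INR _)), Rinv_l in Hlt
    by (apply Rgt_not_eq, INR_S_pos).
  apply (Rmult_lt_compat_r d) in HN; auto.
  unfold Rdiv in HN. rewrite Rmult_assoc, Rinv_l in HN by lra.
  apply le_INR in Hn. pose proof (Rmult_le_compat_l d _ _ (Rlt_le _ _ Hd) Hn).
  rewrite S_INR in Hlt. lra.
Qed.

Lemma dens_ge_upper_density (A : nat -> Prop) d :
  dens_ge A d -> Rbar_le d (upper_density A).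
Proof.
  intros HA. unfold upper_density.
  set (u := fun t => INR (count_below A (S t)) / INR (S t)).
  pose proof (proj2_sig (ex_LimSup_seq u)) as Hl.
  change (proj1_sig (ex_LimSup_seq u)) with (LimSup_seq u) in Hl.
  destruct (LimSup_seq u) as [l| |]; simpl in Hl |- *; auto.
  - apply Rnot_lt_le. intros Hlt.
    destruct (Hl (mkposreal ((d - l) / 2) ltac:(lra))) as [_ [N HN]].
    destruct (HA ((d - l) / 2) ltac:(lra) N) as [n [Hn Hlt']].
    specialize (HN n Hn). unfold u in HN. simpl in HN, Hlt'. lra.
  - destruct (Hl (d - 1)) as [N HN].
    destruct (HA 1 ltac:(lra) N) as [n [Hn Hlt']].
    specialize (HN n Hn). unfold u in HN. lra.
Qed.

Lemma dens_ge_True : dens_ge (fun _ => True) 1.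
Proof.
  intros eps He N. exists N. split; auto.
  rewrite count_below_True. unfold Rdiv.
  rewrite Rinv_r; [lra | apply Rgt_not_eq, INR_S_pos].
Qed.

(** ** The iteration *)

Definition geom (x : R) (m : nat) : R := sum_f_R0 (fun i => x ^ i) m.

(** This form matches the density budget of a step: [delta * geom x (S m)] splits into [delta] for
    one class and [delta * geom x m] for each of [x] others. *)
Lemma geom_S x m : geom x (S m) = 1 + x * geom x m.
Proof.
  unfold geom. induction m as [|m IH]; [simpl; ring|].
  rewrite tech5 in IH. rewrite (tech5 _ (S m)), tech5. simpl pow in *. lra.
Qed.

Lemma geom_ge_1 x m : 0 <= x -> 1 <= geom x m.
Proof.
  intros Hx. induction m as [|m IH]; [unfold geom; simpl; lra|].
  rewrite geom_S. nra.
Qed.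

(** The new term is at most [x * (1 + x) ^ m], exactly the growth of the power from [m] to [S m]. *)
Lemma geom_le_pow x m : 0 <= x -> geom x m <= (1 + x) ^ m.
Proof.
  intros Hx. induction m as [|m IH]; [unfold geom; simpl; lra|].
  unfold geom in *. rewrite tech5. simpl.
  assert (x ^ m <= (1 + x) ^ m) by (apply pow_incr; lra).
  nra.
Qed.

Lemma list_sum_pigeonhole (h : nat -> nat) (b : nat) (l : list nat) :
  (b * length l < list_sum (map h l))%nat -> exists c, In c l /\ (b < h c)%nat.
Proof.
  induction l as [|c l IH]; simpl; intros H; [lia|].
  destruct (Nat.lt_ge_cases b (h c)) as [Hc|Hc]; [exists c; auto|].
  destruct IH as [c' [H1 H2]]; [lia|]. exists c'; auto.
Qed.

Lemma list_sum_incr (h : nat -> nat) (c : nat) (l : list nat) :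
  In c l ->
  (S (list_sum (map h l)) <=
   list_sum (map (fun x => if Nat.eq_dec x c then S (h x) else h x) l))%nat.
Proof.
  assert (Hle : forall l, (list_sum (map h l) <=
    list_sum (map (fun x => if Nat.eq_dec x c then S (h x) else h x) l))%nat).
  { clear l. induction l as [|x l IH]; simpl; [lia|].
    destruct (Nat.eq_dec x c); lia. }
  induction l as [|x l IH]; simpl; [tauto|].
  specialize (Hle l).
  intros [->|H]; destruct (Nat.eq_dec _ _) as [E|E]; try lia;
    specialize (IH H); lia.
Qed.

Lemma has_tower_le col c h h' T :
  (h <= h')%nat -> has_tower col c h' T -> has_tower col c h T.
Proof.
  intros Hh [A [HA H0]]. exists A. split; auto. intros j Hj. apply HA. lia.
Qed.

(** The classes of [chi] partition [T]. A class of [c0] that reaches [delta] contains [C] and so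
    carries a constant tower of any height. Otherwise some class reaches [e], since else the union
    of all classes would stay below [delta + (r - 1) e]. *)
Lemma dense_tower_step r col (delta e : R) (T : nat -> Prop) :
  (1 <= r)%nat -> is_coloring r col -> infinite_nat T ->
  dens_ge T (delta + (INR r - 1) * e) ->
  (exists c T', (forall h, has_tower col c h T') /\ dens_ge T' delta) \/
  (exists c T' C, (1 <= c <= r)%nat /\ (forall w, T' w -> T w) /\
     (forall w, C w -> T w) /\ infinite_nat C /\
     (forall v, T' v -> attached col c C v) /\ dens_ge T' e).
Proof.
  intros Hr Hcol Hinf HT.
  destruct (cohesive_subset r col T Hcol Hinf)
    as [C [chi [c0 [HC [HCinf [Hchi [Hc0 [HCc0 Hatt]]]]]]]].
  set (Y := fun c w => T w /\ chi w = c).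
  destruct (classic (dens_ge (Y c0) delta)) as [Hd|Hd].
  { left. exists c0, (Y c0). split; auto. intros h.
    apply has_tower_constant with (C := C); auto.
    - intros w Hw. split; auto.
    - intros v [_ <-]. apply Hatt. }
  right.
  destruct (classic (exists c, (1 <= c <= r)%nat /\ dens_ge (Y c) e))
    as [[c [Hc Hdc]]|Hno].
  { exists c, (Y c), C. split; [exact Hc|]. split; [now intros w [Hw _]|].
    split; [exact HC|]. split; [exact HCinf|]. split; [|exact Hdc].
    intros v [_ <-]. apply Hatt. }
  exfalso.
  (* Removing [c0], which is charged [delta], leaves [r - 1] colours charged [e] each. *)
  destruct (in_split c0 (seq 1 r)) as [l1 [l2 El]].
  { apply in_seq. lia. }
  assert (Hlen : length (l1 ++ l2) = (r - 1)%nat).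
  { pose proof (length_seq r 1) as H. rewrite El, length_app in H.
    rewrite length_app. simpl in H. lia. }
  refine (not_dens_ge_finite_union (Y c0) Y (l1 ++ l2) delta e Hd _ _).
  - intros c Hc Hdc. apply Hno. exists c. split; auto.
    assert (In c (seq 1 r)) as H.
    { rewrite El. apply in_app_iff in Hc. apply in_app_iff. simpl. tauto. }
    apply in_seq in H. lia.
  - rewrite Hlen, minus_INR by lia. simpl (INR 1).
    revert HT. apply dens_ge_subset. intros w Hw.
    assert (In (chi w) (seq 1 r)) as H.
    { apply in_seq. specialize (Hchi w). lia. }
    rewrite El in H. apply in_app_iff in H. simpl in H.
    destruct H as [H|[H|H]].
    + right. exists (chi w). split; [apply in_app_iff; auto|]. now split.
    + left. now split.
    + right. exists (chi w). split; [apply in_app_iff; auto|]. now split.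
Qed.

(** Here [m] counts the steps left and [h c] the height of the tower in colour [c] over the current
    [T]. A step lowers [m] by one and raises one height by one. At [m = 0] the heights sum to more
    than [(k - 2) * r], so one of them is at least [k - 1]. *)
Lemma dense_tower_iter k r col (delta : R) :
  (2 <= k)%nat -> (1 <= r)%nat -> is_coloring r col -> 0 < delta ->
  forall m T h,
    (forall c, (1 <= c <= r)%nat -> has_tower col c (h c) T) ->
    dens_ge T (delta * geom (INR r - 1) m) ->
    ((k - 2) * r + 1 <= m + list_sum (map h (seq 1 r)))%nat ->
    exists c T', has_tower col c (k - 1) T' /\ dens_ge T' delta.
Proof.
  intros Hk Hr Hcol Hd.
  assert (Hx : 0 <= INR r - 1) by (apply le_INR in Hr; simpl in Hr; lra).
  induction m as [|m IH]; intros T h Hh HT Hsum.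
  - destruct (list_sum_pigeonhole h (k - 2) (seq 1 r)) as [c [Hc Hlt]].
    { rewrite length_seq. simpl in Hsum. lia. }
    apply in_seq in Hc. exists c, T. split.
    + apply has_tower_le with (h c); [lia|]. apply Hh. lia.
    + unfold geom in HT. simpl in HT. now rewrite Rmult_1_r in HT.
  - pose proof (geom_ge_1 (INR r - 1) (S m) Hx) as H1.
    destruct (dense_tower_step r col delta (delta * geom (INR r - 1) m) T)
      as [[c [T' [H2 H3]]]|[c [T' [C [Hc [HT' [HC [HCi [Hatt Hdens]]]]]]]]]; auto.
    + apply dens_ge_infinite with (delta * geom (INR r - 1) (S m)); auto. nra.
    + replace (delta + (INR r - 1) * (delta * geom (INR r - 1) m))
        with (delta * geom (INR r - 1) (S m)); auto.
      rewrite geom_S. ring.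
    + exists c, T'. auto.
    (* The tower in colour [c] gains the level [C]; those in the other colours are merely restricted
       to [T']. *)
    + apply (IH T' (fun x => if Nat.eq_dec x c then S (h x) else h x)); auto.
      * intros x Hx'. destruct (Nat.eq_dec x c) as [->|E].
        -- apply has_tower_extend with T C; auto.
        -- apply has_tower_subset with T; auto.
      * pose proof (list_sum_incr h c (seq 1 r)) as H4.
        specialize (H4 ltac:(apply in_seq; lia)). lia.
Qed.

(** * Lower bounds for the Ramsey upper density *)

Lemma Rd_ge k r V adj :
  simple_graph V adj -> countably_infinite V ->
  one_way_locally_finite k V adj -> (1 <= r)%nat ->
  Rbar_le (Finite (1 / geom (INR r - 1) ((k - 2) * r + 1))) (Rd r V adj).
Proof.
  intros HG Hinf Hlf Hr. unfold Rd, Rbar_glb.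
  match goal with |- Rbar_le _ (proj1_sig ?e) => destruct e as [g Hg] end.
  simpl proj1_sig. apply Hg. intros d [col [Hcol ->]].
  set (delta := 1 / geom (INR r - 1) ((k - 2) * r + 1)).
  assert (Hx : 0 <= INR r - 1) by (apply le_INR in Hr; simpl in Hr; lra).
  pose proof (geom_ge_1 (INR r - 1) ((k - 2) * r + 1) Hx) as Hge.
  assert (Hd : 0 < delta) by (apply Rdiv_lt_0_compat; lra).
  (* The iteration starts from all of $\mathbb{N}$, of density 1, with every height 0; [delta] is
     chosen so that this density is exactly the budget for [(k - 2) * r + 1] steps. *)
  destruct (dense_tower_iter k r col delta (proj1 Hlf) Hr Hcol Hd
              ((k - 2) * r + 1) (fun _ => True) (fun _ => 0%nat))
    as [c [T [HT HTd]]].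
  - intros c _. apply has_tower_0.
  - replace (delta * geom (INR r - 1) ((k - 2) * r + 1)) with 1.
    + apply dens_ge_True.
    + unfold delta. field. lra.
  - lia.
  - destruct (has_tower_mono_copy k V adj col c T HG Hinf Hlf HT)
      as [emb [Hmono Hcov]].
    { now apply dens_ge_infinite with delta. }
    apply Rbar_le_trans with (upper_density (fun n => exists v, emb v = n)).
    + apply dens_ge_upper_density. now apply dens_ge_subset with T.
    + unfold Rd_col, Rbar_lub.
      match goal with |- Rbar_le _ (proj1_sig ?e) => destruct e as [b Hb] end.
      apply Hb. right. exists emb. auto.
Qed.

Lemma geom_1 m : geom 1 m = INR (S m).
Proof.
  induction m as [|m IH]; [reflexivity|].
  rewrite geom_S, IH, (S_INR (S m)). ring.
Qed.

Theorem mainTheorem1 (k r : nat) (V : Type) (adj : V -> V -> Prop)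
  (HG : simple_graph V adj) (Hinf : countably_infinite V)
  (Hlf : one_way_locally_finite k V adj) :
  ((k = 2)%nat -> (1 <= r)%nat -> Rbar_le (Finite (1 / INR r)) (Rd r V adj)) /\
  ((2 <= k)%nat ->
     Rbar_le (Finite (1 / (2 * (INR k - 1)))) (Rd 2 V adj)) /\
  ((3 <= r)%nat -> (3 <= k)%nat ->
     Rbar_le
       (Finite (1 / sum_f_R0 (fun i => (INR r - 1) ^ i) ((k - 2) * r + 1)))
       (Rd r V adj) /\
     1 / sum_f_R0 (fun i => (INR r - 1) ^ i) ((k - 2) * r + 1)
       >= 1 / INR r ^ ((k - 2) * r + 1)).
Proof.
  split; [|split].
  - intros -> Hr. pose proof (Rd_ge 2 r V adj HG Hinf Hlf Hr) as H.
    (* For [k = 2] only the terms [1] and [r - 1] remain. *)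
    replace (geom (INR r - 1) ((2 - 2) * r + 1)) with (INR r) in H; auto.
    unfold geom. simpl. ring.
  - intros Hk. pose proof (Rd_ge k 2 V adj HG Hinf Hlf ltac:(lia)) as H.
    replace (geom (INR 2 - 1) ((k - 2) * 2 + 1)) with (2 * (INR k - 1)) in H;
      auto.
    replace (INR 2 - 1) with 1 by (simpl; ring). rewrite geom_1.
    (* For [r = 2] every term is 1, and the number of terms is one more than the top index. *)
    replace (S ((k - 2) * 2 + 1)) with (2 * (k - 1))%nat by lia.
    rewrite mult_INR, minus_INR by lia. simpl. ring.
  - intros Hr Hk.
    split; [apply (Rd_ge k r V adj HG Hinf Hlf); lia|].
    assert (Hx : 0 <= INR r - 1).
    { apply le_INR in Hr. simpl in Hr. lra. }
    pose proof (geom_ge_1 (INR r - 1) ((k - 2) * r + 1) Hx) as H1.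
    pose proof (geom_le_pow (INR r - 1) ((k - 2) * r + 1) Hx) as H2.
    replace (1 + (INR r - 1)) with (INR r) in H2 by ring.
    apply Rle_ge. unfold Rdiv. rewrite !Rmult_1_l.
    apply Rinv_le_contravar; [|exact H2].
    unfold geom in H1. lra.
Qed.
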